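(* There exist universal constants $C_4>0$ and $c>0$ such that the following holds. Let $L\ge\mu>0$ with $\kappa=L/\mu>C_4$, let $0<\varepsilon<0.01$ and $D>0$. Then there exist positive integers $T$ and $t$ such that the function $\tilde g:\mathbb{R}^{Tt}\to\mathbb{R}$, $\tilde g(\mathbf{x})=\frac{LT^{-1}D^2}{37}\,g_{T,t}\big(\mathbf{y}-T^{1/2}D^{-1}\mathbf{x}\big)$, is $L$-smooth and satisfies the $\mu$-PL condition, and any first-order zero-respecting algorithm with $\mathbf{x}^{(0)}=\mathbf{0}$ needs at least $c\,\kappa\log\frac1\varepsilon$ gradient computations to find a point $\mathbf{x}$ satisfying $\tilde g(\mathbf{x})-\inf\tilde g\le\varepsilon\,(\tilde g(\mathbf{x}^{(0)})-\inf\tilde g)$ (i.e. the lower bound is $\Omega(\kappa\log\frac1\varepsilon)$).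
   Context: A differentiable $f:\mathbb{R}^d\to\mathbb{R}$ is $L$-smooth if $\|\nabla f(\mathbf{x})-\nabla f(\mathbf{z})\|\le L\|\mathbf{x}-\mathbf{z}\|$ for all $\mathbf{x},\mathbf{z}$; it satisfies the $\mu$-PL condition if $\|\nabla f(\mathbf{x})\|^2\ge2\mu(f(\mathbf{x})-\inf f)$ for all $\mathbf{x}$. For a constant $y>0$ define $v_y:\mathbb{R}\to\mathbb{R}$ by $v_y(x)=\frac12x^2$ if $x\le\frac{31}{32}y$; $v_y(x)=\frac12x^2-16(x-\frac{31}{32}y)^2$ if $\frac{31}{32}y<x\le y$; $v_y(x)=\frac12x^2-\frac{y^2}{32}+16(x-\frac{33}{32}y)^2$ if $y<x\le\frac{33}{32}y$; $v_y(x)=\frac12x^2-\frac{y^2}{32}$ if $x>\frac{33}{32}y$. For $\mathbf{x}\in\mathbb{R}^{Tt}$, with the convention $\mathbf{x}_0=0$, let $q_{T,t}(\mathbf{x})=\frac12\sum_{i=0}^{t-1}\big[(\frac78\mathbf{x}_{iT}-\mathbf{x}_{iT+1})^2+\sum_{j=1}^{T-1}(\mathbf{x}_{iT+j+1}-\mathbf{x}_{iT+j})^2\big]$. Let $\mathbf{y}\in\mathbb{R}^{Tt}$ be given by $\mathbf{y}_{qT+b}=(7/8)^q$ for $q\in\{0,\dots,t-1\}$, $b\in\{1,\dots,T\}$, and $g_{T,t}(\mathbf{x})=q_{T,t}(\mathbf{x})+\sum_{i=1}^{Tt}v_{\mathbf{y}_i}(\mathbf{x}_i)$. A first-order algorithm,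 applied to a differentiable $f:\mathbb{R}^d\to\mathbb{R}$, produces iterates $\mathbf{x}^{(0)},\mathbf{x}^{(1)},\dots$ where each $\mathbf{x}^{(i)}$ is a (deterministic) function of $\mathbf{x}^{(0)},\nabla f(\mathbf{x}^{(0)}),\dots,\mathbf{x}^{(i-1)},\nabla f(\mathbf{x}^{(i-1)})$; producing $\mathbf{x}^{(k)}$ counts as $k$ gradient computations. It is zero-respecting if for every $f$ and $n\ge1$, $\mathrm{supp}(\mathbf{x}^{(n)}-\mathbf{x}^{(0)})\subseteq\bigcup_{i=0}^{n-1}\mathrm{supp}(\nabla f(\mathbf{x}^{(i)}))$, where $\mathrm{supp}(\mathbf{v})=\{i:\mathbf{v}_i\ne0\}$. *)

(* Defs.v *)
From HB Require Import structures.
From mathcomp Require Import all_boot all_order all_algebra.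
From mathcomp Require Import all_classical all_reals all_analysis.

Set Implicit Arguments. Unset Strict Implicit. Unset Printing Implicit Defensive.
Import Order.TTheory GRing.Theory Num.Theory.
Import numFieldNormedType.Exports.
Local Open Scope ring_scope.


(* vectors of R^d are row vectors 'rV[R]_d, coordinates indexed 0..d-1
   (coordinate i of the paper is entry i-1 here). *)

Definition enorm (R : realType) (d : nat) (x : 'rV[R]_d) : R :=
  Num.sqrt (\sum_(i < d) (x 0 i) ^+ 2).

Definition grad (R : realType) (d : nat) (f : 'rV[R]_d -> R) (x : 'rV[R]_d) : 'rV[R]_d :=
  \row_(i < d) ('d f x (delta_mx 0 i : 'rV[R]_d)).

Definition differentiable_everywhere (R : realType) (d : nat) (f : 'rV[R]_d -> R) : Prop :=
  forall x : 'rV[R]_d, differentiable f x.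

Definition L_smooth (R : realType) (d : nat) (L : R) (f : 'rV[R]_d -> R) : Prop :=
  differentiable_everywhere f /\
  forall x z : 'rV[R]_d, enorm (grad f x - grad f z) <= L * enorm (x - z).

Definition inff (R : realType) (d : nat) (f : 'rV[R]_d -> R) : R := inf (range f).

Definition PL (R : realType) (d : nat) (mu : R) (f : 'rV[R]_d -> R) : Prop :=
  forall x : 'rV[R]_d, (enorm (grad f x)) ^+ 2 >= 2 * mu * (f x - inff f).

Definition v_fun (R : realType) (y x : R) : R :=
  if x <= 31/32 * y then x ^+ 2 / 2
  else if x <= y then x ^+ 2 / 2 - 16 * (x - 31/32 * y) ^+ 2
  else if x <= 33/32 * y then x ^+ 2 / 2 - y ^+ 2 / 32 + 16 * (x - 33/32 * y) ^+ 2
  else x ^+ 2 / 2 - y ^+ 2 / 32.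

(** coordinate k (1-based, paper convention) of x, with x_0 = 0
    (and 0 beyond the dimension, never used) *)
Definition xc (R : realType) (d : nat) (x : 'rV[R]_d) (k : nat) : R :=
  match k with
  | 0 => 0
  | k'.+1 => match (insub k' : option 'I_d) with
             | Some i => x 0 i
             | None => 0
             end
  end.

Definition q_fun (R : realType) (T t : nat) (x : 'rV[R]_(T * t)) : R :=
  (\sum_(0 <= i < t)
     ((7/8 * xc x (i * T) - xc x (i * T + 1)) ^+ 2
      + \sum_(1 <= j < T) (xc x (i * T + j + 1) - xc x (i * T + j)) ^+ 2)) / 2.

(** the vector y: y_{qT+b} = (7/8)^q for b in 1..T, i.e. (0-based index m)
    entry m is (7/8)^(m %/ T) *)
Definition y_vec (R : realType) (T t : nat) : 'rV[R]_(T * t) :=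
  \row_(m < T * t) ((7/8 : R) ^+ (m %/ T)).

Definition g_fun (R : realType) (T t : nat) (x : 'rV[R]_(T * t)) : R :=
  q_fun x + \sum_(m < T * t) v_fun (y_vec R T t 0 m) (x 0 m).

Definition gtilde (R : realType) (L D : R) (T t : nat) (x : 'rV[R]_(T * t)) : R :=
  L * (T%:R)^-1 * D ^+ 2 / 37 * g_fun (y_vec R T t - (Num.sqrt (T%:R) / D) *: x).

(** First-order algorithms: the next iterate is a deterministic function of
    the history [(x^(0), grad f x^(0)); ...; (x^(i-1), grad f x^(i-1))]. *)
Definition algorithm (R : realType) (d : nat) := seq ('rV[R]_d * 'rV[R]_d) -> 'rV[R]_d.

Fixpoint history (R : realType) (d : nat) (A : algorithm R d) (f : 'rV[R]_d -> R) (n : nat)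
  : seq ('rV[R]_d * 'rV[R]_d) :=
  match n with
  | 0 => [::]
  | n'.+1 => let h := history A f n' in rcons h (A h, grad f (A h))
  end.

Definition iterate (R : realType) (d : nat) (A : algorithm R d) (f : 'rV[R]_d -> R) (n : nat)
  : 'rV[R]_d := A (history A f n).

Definition supp (R : realType) (d : nat) (v : 'rV[R]_d) : {set 'I_d} := [set i | v 0 i != 0].

Definition zero_respecting (R : realType) (d : nat) (A : algorithm R d) : Prop :=
  forall f : 'rV[R]_d -> R, differentiable_everywhere f ->
  forall n : nat, (1 <= n)%N ->
    supp (iterate A f n - iterate A f 0)
      \subset \bigcup_(i < n) supp (grad f (iterate A f i)).

(* Main.v *)
(* Put w = y - (sqrt T / D) x and G = grad g(w), and say that coordinate i is in
   its well when 31/32 y_i < w_i < 33/32 y_i.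

   PL condition. Outside the wells v' is the identity, so testing G against w
   bounds the energy of the coordinates outside the wells by |G|^2 plus the
   energy of those inside, and the latter is at most O(T) y_i^2 where i is the
   first coordinate in its well, because y decays geometrically from block to
   block. Finally |G|^2 >= y_i^2 / 64: before i the gradient is linear, and an
   energy estimate shows that w must jump by at least w_i / 5 when it reaches i;
   after i either w stays near y and G_i is large, or w overshoots the wells,
   and then a small gradient would force w to grow up to the last coordinate,
   whose equation it violates. Altogether g(w) <= 1455 T |G|^2.

   Lower bound. At y all wells have slope zero, so the gradient at a point that
   agrees with y from coordinate n on is supported on the first n + 1
   coordinates. Hence the last block is untouched during the first T (t - 1)
   steps, and it alone contributes T (49/64)^(t - 1) to g up to a constant,
   against O(T) at the start. Take T of order kappa and t of order
   log (1 / epsilon). *)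
Require Import Defs.
From HB Require Import structures.
From mathcomp Require Import all_boot all_order all_algebra.
From mathcomp Require Import all_classical all_reals all_analysis.
From mathcomp Require Import ring lra.
Import Order.TTheory GRing.Theory Num.Theory.
Import numFieldNormedType.Exports.
Local Open Scope ring_scope.
Set Implicit Arguments.
Unset Strict Implicit.
Unset Printing Implicit Defensive.

(** * The one-dimensional well *)

(** The derivative of [v_fun y], as [v_fun_taylor] confirms. *)
Definition dv_fun (R : realType) (y x : R) : R :=
  if x <= 31/32 * y then x
  else if x <= y then 31 * (y - x)
  else if x <= 33/32 * y then 33 * (x - y)
  else x.

Section ScalarWell.
Variable R : realType.
Implicit Types x y z h u : R.

Let pos u := Num.max 0 u.

Let pos_taylor u h :
  0 <= pos (u + h) ^+ 2 - pos u ^+ 2 - 2 * pos u * h <= h ^+ 2.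
Proof.
rewrite /pos; case: (lerP 0 u) => hu; case: (lerP 0 (u + h)) => huh;
  apply/andP; split; nra.
Qed.

Let posN u : u <= 0 -> pos u = 0.
Proof. by move=> u0; rewrite /pos; case: lerP => // ?; lra. Qed.

Let posP u : 0 <= u -> pos u = u.
Proof. by move=> u0; rewrite /pos; case: lerP => // ?; lra. Qed.

(** A form without cases, in squared positive parts, reduces the expansion of the well to
    [pos_taylor]. *)
Let v_funE y x : 0 < y -> v_fun y x =
  x ^+ 2 / 2 - 16 * pos (x - 31/32 * y) ^+ 2 + 32 * pos (x - y) ^+ 2
  - 16 * pos (x - 33/32 * y) ^+ 2.
Proof.
move=> y0; rewrite /v_fun; case: lerP => h1.
  by rewrite !posN; [field | lra ..].
case: lerP => h2.
  by rewrite posP ?[pos (x - y)]posN ?[pos (x - 33/32 * y)]posN; [field | lra ..].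
case: lerP => h3.
  by rewrite posP ?[pos (x - y)]posP ?[pos (x - 33/32 * y)]posN; [field | lra ..].
by rewrite !posP; [field | lra ..].
Qed.

Let dv_funE y x : 0 < y -> dv_fun y x =
  x - 32 * pos (x - 31/32 * y) + 64 * pos (x - y) - 32 * pos (x - 33/32 * y).
Proof.
move=> y0; rewrite /dv_fun; case: lerP => h1.
  by rewrite !posN; [field | lra ..].
case: lerP => h2.
  by rewrite posP ?[pos (x - y)]posN ?[pos (x - 33/32 * y)]posN; [field | lra ..].
case: lerP => h3.
  by rewrite posP ?[pos (x - y)]posP ?[pos (x - 33/32 * y)]posN; [field | lra ..].
by rewrite !posP; [field | lra ..].
Qed.

(** The remainder is h^2/2 - 16a + 32b - 16c with a, b, c in [0, h^2], hence at most 65/2 h^2 in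
    absolute value. *)
Lemma v_fun_taylor y x h : 0 < y ->
  `|v_fun y (x + h) - v_fun y x - dv_fun y x * h| <= 33 * h ^+ 2.
Proof.
move=> y0; rewrite !v_funE// dv_funE//.
have E a : x + h - a = x - a + h by ring.
rewrite !E.
have /andP[a1 a2] := pos_taylor (x - 31/32 * y) h.
have /andP[b1 b2] := pos_taylor (x - y) h.
have /andP[c1 c2] := pos_taylor (x - 33/32 * y) h.
have hh := sqr_ge0 h.
by rewrite ler_norml; apply/andP; split; lra.
Qed.

Let dv_funP y x : 0 < y ->
  [\/ x <= 31/32 * y /\ dv_fun y x = x,
      31/32 * y <= x <= y /\ dv_fun y x = 31 * (y - x),
      y <= x <= 33/32 * y /\ dv_fun y x = 33 * (x - y)
    | 33/32 * y <= x /\ dv_fun y x = x].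
Proof.
rewrite /dv_fun => y0; case: lerP => [?|/ltW ->]; first by constructor 1.
case: lerP => [_|/ltW ->]; first by constructor 2.
by case: lerP => [_|/ltW ->]; [constructor 3 | constructor 4].
Qed.

(** The four linear pieces have slopes 1, -31, 33, 1 and match at their ends. The bound is squared
    because it is summed over coordinates. *)
Lemma dv_fun_lipschitz y x z : 0 < y ->
  (dv_fun y x - dv_fun y z) ^+ 2 <= 33 ^+ 2 * (x - z) ^+ 2.
Proof.
move=> y0; wlog xz : x z / x <= z.
  move=> H; case: (leP x z) => [|/ltW] /H //.
  by rewrite -sqrrN opprB -[(z - x) ^+ 2]sqrrN opprB.
have [h1 h2] : - (33 * (z - x)) <= dv_fun y z - dv_fun y x /\
    dv_fun y z - dv_fun y x <= 33 * (z - x).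
  by case: (dv_funP x y0) => -[? ->]; case: (dv_funP z y0) => -[? ->]; split; lra.
nra.
Qed.

Lemma dv_fun_outside y x : (x <= 31/32 * y) || (33/32 * y <= x) -> 0 < y ->
  dv_fun y x = x.
Proof.
by move=> /orP h y0; case: (dv_funP x y0) => -[? ->] //; case: h; lra.
Qed.

Lemma dv_fun_ge0 y x : 0 < y -> 0 <= x -> 0 <= dv_fun y x.
Proof. by move=> y0 x0; case: (dv_funP x y0) => -[? ->] //; lra. Qed.

Lemma dv_fun_mul_ge0 y x : 0 < y -> 0 <= dv_fun y x * x.
Proof. by move=> y0; case: (dv_funP x y0) => -[? ->] //; nra. Qed.

Lemma dv_fun_min y : 0 < y -> dv_fun y y = 0.
Proof. by move=> y0; case: (dv_funP y y0) => -[? ->] //; lra. Qed.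

Lemma v_fun_ge0 y x : 0 < y -> 0 <= v_fun y x.
Proof.
by move=> y0; rewrite /v_fun; do 3?(case: ifPn; rewrite -?ltNge => ?); nra.
Qed.

Lemma v_fun_le y x : 0 < y -> v_fun y x <= x ^+ 2 / 2.
Proof.
by move=> y0; rewrite /v_fun; do 3?(case: ifPn; rewrite -?ltNge => ?); nra.
Qed.

Lemma v_fun_min y : 0 < y -> v_fun y y = 31/64 * y ^+ 2.
Proof.
by move=> y0; rewrite /v_fun; do 3?(case: ifPn; rewrite -?ltNge => ?); lra.
Qed.

Lemma v_fun0 y : 0 < y -> v_fun y 0 = 0.
Proof.
by move=> y0; rewrite /v_fun; do 3?(case: ifPn; rewrite -?ltNge => ?); lra.
Qed.

End ScalarWell.

(** * Chains of wells *)

(** The boundary term vanishes on the whole chain, whose end is free; on a chain cut at the first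
    well it is the term that gets estimated. *)
Lemma sum_by_parts (R : realType) (a D h : nat -> R) n : h 0 = 0 ->
  \sum_(k < n) D k * (h k.+1 - a k * h k) =
  \sum_(k < n) (D k - a k.+1 * D k.+1) * h k.+1 + a n * D n * h n.
Proof.
move=> h0; elim: n => [|n IH]; first by rewrite !big_ord0 h0 mulr0 addr0.
by rewrite !big_ord_recr /= IH; ring.
Qed.

Section Chain.
Variable R : realType.
Variables T t : nat.
Implicit Types (w h : nat -> R) (i j k m n : nat).

Local Notation N := (T * t)%N.

(** The factor on entering a new block. Coordinate [k] of a row is [w k.+1], with [w 0 = 0];
    [level], [diffs] and [chain_grad] are indexed from 0. *)
Definition link k : R := if (T %| k)%N then 7/8 else 1.

Definition level k : R := (7/8) ^+ (k %/ T).

(** The value 0 from [N] on encodes the free end, so that [chain_grad] needs no special case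
    there. *)
Definition diffs w k : R :=
  if (k < N)%N then w k.+1 - link k * w k else 0.

Definition chain_energy w : R := (\sum_(k < N) diffs w k ^+ 2) / 2.

(** The partial derivative in [w k.+1] of [chain_energy] plus the wells. *)
Definition chain_grad w k : R :=
  diffs w k - link k.+1 * diffs w k.+1 + dv_fun (level k) (w k.+1).

Lemma link_bounds k : 7/8 <= link k <= 1.
Proof. by rewrite /link; case: ifP => _; apply/andP; split; lra. Qed.

Lemma link_sub_sq_le k (a b : R) :
  (a - link k * b) ^+ 2 <= 2 * a ^+ 2 + 2 * b ^+ 2.
Proof.
have /andP[a1 a2] := link_bounds k.
have h : 0 <= (1 - link k ^+ 2) * b ^+ 2.
  by apply: mulr_ge0 (sqr_ge0 _); nra.
by have := sqr_ge0 (a + link k * b); lra.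
Qed.

Lemma level_gt0 k : 0 < level k.
Proof. by apply: exprn_gt0; lra. Qed.

(** Thus all differences of [y] but the first vanish. *)
Lemma levelS k : (0 < T)%N -> level k.+1 = link k.+1 * level k.
Proof.
move=> T0; rewrite /level /link divnS //; case: (T %| k.+1)%N => /=.
  by rewrite add1n exprS.
by rewrite add0n mul1r.
Qed.

Lemma levelDT k : (0 < T)%N -> level (k + T) = 7/8 * level k.
Proof. by move=> T0; rewrite /level divnDr // divnn T0 addn1 exprS. Qed.

Lemma level_nincr i j : (i <= j)%N -> level j <= level i.
Proof. by move=> ij; apply: ler_wiXn2l; [lra | lra | exact: leq_div2r]. Qed.

(* 64/15 is the sum of the geometric series of ratio (7/8)^2. *)
Lemma sum_level_sq i n : (0 < T)%N ->
  \sum_(j < n * T) level (i + j) ^+ 2 <= 64/15 * T%:R * level i ^+ 2.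
Proof.
move=> T0; elim: n i => [|n IH] i.
  by rewrite big_ord0; apply: mulr_ge0 (sqr_ge0 _); apply: mulr_ge0 (ler0n _ _); lra.
rewrite mulSn big_split_ord /=.
have h1 : \sum_(j < T) level (i + j) ^+ 2 <= T%:R * level i ^+ 2.
  rewrite mulr_natl -[T in X in _ <= X]card_ord -sumr_const.
  apply: ler_sum => j _; rewrite lerXn2r ?nnegrE ?(ltW (level_gt0 _)) //.
  by apply: level_nincr; exact: leq_addr.
have h2 := IH (i + T)%N; rewrite levelDT // in h2.
under [X in _ + X <= _]eq_bigr do rewrite addnA.
by rewrite exprMn in h2; lra.
Qed.

(** * Lower bounds on the gradient along a chain *)

Section Forward.
Variable w : nat -> R.
Hypothesis T_gt0 : (0 < T)%N.
Hypothesis w0 : w 0 = 0.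
Local Notation D := (diffs w).
Local Notation G := (chain_grad w).

Lemma diffs_last : D N = 0. Proof. by rewrite /diffs ltnn. Qed.

Lemma diffs_lt k : (k < N)%N -> D k = w k.+1 - link k * w k.
Proof. by rewrite /diffs => ->. Qed.

(* Above the well the sequence keeps growing as long as the gradient is small,
   which is impossible at the free end. *)
Lemma chain_grad_overshoot i : (i < N)%N -> 0 <= D i ->
  33/32 * level i <= w i.+1 ->
  exists2 j, (j < N)%N & w i.+1 / 2 <= G j.
Proof.
move: {-2}(N - i)%N (erefl (N - i)%N) => n.
elim: n i => [|n IH] i hn iN Di wi; first by move: iN; rewrite -subn_gt0 -hn.
have Y0 := level_gt0 i.
have [h|h] := lerP (w i.+1 / 2) (G i); first by exists i.
rewrite /chain_grad dv_fun_outside ?wi ?orbT // in h.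
have /andP[a1 a2] := link_bounds i.+1.
have h3 : 0 < link i.+1 * D i.+1 - w i.+1 / 2 by lra.
have wpos : 0 < w i.+1 by lra.
(* A gradient below w/2 passes a difference above w/2 on to the next coordinate, as [link] is at
   most 1; at the end of the chain that difference is 0. *)
have DS : w i.+1 / 2 < D i.+1 by nra.
have [iN'|iN'] := ltnP i.+1 N; last first.
  have E : i.+1 = N by apply/eqP; rewrite eqn_leq iN' iN.
  by rewrite E diffs_last -E in DS; clear -DS wpos; lra.
have wE := diffs_lt iN'.
have w2 : w i.+1 <= w i.+2 by nra.
have [|||j jN hj] := IH i.+1 _ iN'.
- by rewrite subnS -hn.
- by lra.
- have : 0 <= link i.+1 * (w i.+1 - 33/32 * level i) by apply: mulr_ge0; lra.
  by rewrite levelS // => ?; lra.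
by exists j => //; lra.
Qed.

Lemma sum_sq_ge (G' : nat -> R) j (z : R) : (j < N)%N -> 0 <= z -> z <= G' j ->
  z ^+ 2 <= \sum_(k < N) G' k ^+ 2.
Proof.
move=> jN z0 zj; rewrite (bigD1 (Ordinal jN)) //= -[leLHS]addr0 lerD //.
  by rewrite lerXn2r ?nnegrE //; lra.
by apply: sumr_ge0 => k _; exact: sqr_ge0.
Qed.

Definition in_well i : bool := (31/32 * level i < w i.+1 < 33/32 * level i).

Lemma dv_fun_notin_well i : ~~ in_well i -> dv_fun (level i) (w i.+1) = w i.+1.
Proof.
rewrite /in_well negb_and -!leNgt => h.
by apply: dv_fun_outside => //; exact: level_gt0.
Qed.

(* The discrete energy on the coordinates before the first well, where the
   gradient is linear, forces a jump when entering this well. *)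
Lemma first_well_jump i : (i < N)%N -> in_well i ->
  (forall j, (j < i)%N -> ~~ in_well j) ->
  level i ^+ 2 / 64 <= \sum_(k < N) G k ^+ 2 \/ 1/5 * w i.+1 <= D i.
Proof.
move=> iN /andP[wl wu] hj.
have Y0 := level_gt0 i.
have := sum_by_parts link D i w0.
have -> : \sum_(k < i) D k * (w k.+1 - link k * w k) = \sum_(k < i) D k ^+ 2.
  apply: eq_bigr => k _; rewrite diffs_lt ?expr2 //.
  exact: ltn_trans (ltn_ord k) iN.
have -> : \sum_(k < i) (D k - link k.+1 * D k.+1) * w k.+1 =
  \sum_(k < i) G k * w k.+1 - \sum_(k < i) w k.+1 ^+ 2.
  rewrite -sumrB; apply: eq_bigr => k _.
  by rewrite /chain_grad dv_fun_notin_well ?hj //; ring.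
have hG : \sum_(k < i) G k * w k.+1 <=
    (\sum_(k < i) G k ^+ 2) / 2 + (\sum_(k < i) w k.+1 ^+ 2) / 2.
  rewrite !mulr_suml -big_split /=; apply: ler_sum => k _.
  by have := sqr_ge0 (G k - w k.+1); lra.
have hD : 0 <= \sum_(k < i) D k ^+ 2 by apply: sumr_ge0 => k _; exact: sqr_ge0.
have hGN : \sum_(k < i) G k ^+ 2 <= \sum_(k < N) G k ^+ 2.
  rewrite -(subnKC (ltnW iN)) big_split_ord /= lerDl.
  by apply: sumr_ge0 => k _; exact: sqr_ge0.
(* Only the last term of the sum, just before the well, is kept. *)
have hw : (link i * w i) ^+ 2 <= \sum_(k < i) w k.+1 ^+ 2.
  case: {+}i => [|m]; first by rewrite w0 mulr0 expr0n big_ord0.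
  rewrite big_ord_recr /= -[leLHS]add0r lerD //.
    by apply: sumr_ge0 => k _; exact: sqr_ge0.
  have /andP[a1 a2] := link_bounds m.+1.
  by rewrite exprMn; apply: ler_piMl (sqr_ge0 _) _; nra.
rewrite (diffs_lt iN) => E.
have [h|h] := lerP (1/5 * w i.+1) (w i.+1 - link i * w i); [by right|left].
move: hG hD hGN hw E h.
move: (\sum_(k < i) G k * _) (\sum_(k < i) G k ^+ 2) (\sum_(k < i) D k ^+ 2)
  (\sum_(k < i) w k.+1 ^+ 2) (\sum_(k < N) _) => GW GG DD W GN.
rewrite [link i * _ * _]mulrAC; move: (link i * w i) => z.
move=> hG hD hGN hw E h.
(* 31/40 is 4/5 of 31/32. Since [w i.+1 - z] is below z/4, the boundary term is at most z^2/4 and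
   cannot balance z^2/2 unless the gradient is large. *)
have zb : 31/40 * level i <= z by lra.
have hz : z ^+ 2 / 2 <= GN by nra.
by nra.
Qed.

(** If the next difference is small, the jump gives G_i at least (31/160 - 1/16) of the level, which
    exceeds 1/8. Otherwise the next coordinate passes its well, as 31/32 + 1/16 = 33/32, and
    [chain_grad_overshoot] applies. *)
Lemma first_well_grad i : (i < N)%N -> in_well i ->
  (forall j, (j < i)%N -> ~~ in_well j) ->
  level i ^+ 2 / 64 <= \sum_(k < N) G k ^+ 2.
Proof.
move=> iN iw hj; have [//|hD] := first_well_jump iN iw hj.
have Y0 := level_gt0 i; have /andP[wl wu] := iw.
have /andP[a1 a2] := link_bounds i.+1.
have hv : 0 <= dv_fun (level i) (w i.+1) by apply: dv_fun_ge0 => //; lra.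
suff [j jN hG] : exists2 j, (j < N)%N & level i / 8 <= G j.
  have -> : level i ^+ 2 / 64 = (level i / 8) ^+ 2 by field.
  by apply: sum_sq_ge jN _ hG; lra.
have [h|h] := lerP (D i.+1) (level i.+1 / 16).
  have h1 : link i.+1 * D i.+1 <= link i.+1 * (level i.+1 / 16).
    by rewrite ler_pM2l //; lra.
  have h2 : link i.+1 * level i.+1 <= level i.
    by rewrite levelS // mulrA; apply: ler_piMl (ltW Y0) _; nra.
  by exists i => //; rewrite /chain_grad; lra.
have [iN'|iN'] := ltnP i.+1 N; last first.
  have E : i.+1 = N by apply/eqP; rewrite eqn_leq iN' iN.
  by move: h (level_gt0 i.+1); rewrite E diffs_last; clear; lra.
have DE := diffs_lt iN'.
have w2 : 33/32 * level i.+1 <= w i.+2 by rewrite levelS // in h *; nra.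
have [|j jN hjG] := chain_grad_overshoot iN' _ w2.
  by have := level_gt0 i.+1; lra.
by exists j => //; rewrite levelS // in w2; nra.
Qed.

Lemma chain_grad_dot : \sum_(k < N) G k * w k.+1 =
  \sum_(k < N) D k ^+ 2 + \sum_(k < N) dv_fun (level k) (w k.+1) * w k.+1.
Proof.
have := sum_by_parts link D N w0; rewrite diffs_last mulr0 mul0r addr0.
under eq_bigr => k _ do rewrite -diffs_lt // -expr2.
move=> ->; rewrite -big_split /=; apply: eq_bigr => k _.
by rewrite /chain_grad; ring.
Qed.

Lemma chain_sq_le : \sum_(k < N) w k.+1 ^+ 2 <=
  582 * T%:R * \sum_(k < N) G k ^+ 2.
Proof.
have T1 : 1 <= T%:R :> R by rewrite ler1n.
set GG := \sum_(k < N) G k ^+ 2.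
have GG0 : 0 <= GG by apply: sumr_ge0 => k _; exact: sqr_ge0.
rewrite (bigID (fun k : 'I_N => in_well k)) /=.
set B := \sum_(k < N | in_well k) _; set S := \sum_(k < N | ~~ _) _.
have BS : B + S = \sum_(k < N) w k.+1 ^+ 2.
  by rewrite [RHS](bigID (fun k : 'I_N => in_well k)).
(* The gradient is tested against [w]; outside the wells [dv_fun] is the identity, inside them its
   contribution is nonnegative. *)
have hSB : S <= GG / 2 + (B + S) / 2.
  apply: (@le_trans _ _ (\sum_(k < N) G k * w k.+1)).
    rewrite chain_grad_dot -[leLHS]add0r lerD //.
      by apply: sumr_ge0 => k _; exact: sqr_ge0.
    rewrite [leRHS](bigID (fun k : 'I_N => in_well k)) /= -[leLHS]add0r lerD //.
      by apply: sumr_ge0 => k _; apply: dv_fun_mul_ge0; exact: level_gt0.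
    by apply: ler_sum => k hk; rewrite dv_fun_notin_well // expr2.
  rewrite BS !mulr_suml -big_split /=; apply: ler_sum => k _.
  by have := sqr_ge0 (G k - w k.+1); lra.
(* [hSB] gives B + S <= GG + 2B, and 290.4 = (33/32)^2 * 64/15 * 64: well width, geometric series,
   [first_well_grad]. *)
suff hB : B <= 2904/10 * T%:R * GG by nra.
have [[i [iN iw]]|none] := pselect (exists i, (i < N)%N /\ in_well i); last first.
  have -> : B = 0 by apply: big1 => k hk; exfalso; apply: none; exists k.
  by apply: mulr_ge0 GG0; lra.
have ex : exists i, (i < N)%N && in_well i by exists i; rewrite iN iw.
case: (ex_minnP ex) => m /andP[mN mw] mmin.
have mfirst j : (j < m)%N -> ~~ in_well j.
  move=> jm; apply/negP => jw; have := mmin j.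
  by rewrite (ltn_trans jm mN) jw => /(_ isT); rewrite leqNgt jm.
have hG : level m ^+ 2 / 64 <= GG := first_well_grad mN mw mfirst.
(* Coordinates in a well come no earlier than [m] and are below 33/32 of their level. *)
have hB : B <= (33/32) ^+ 2 * \sum_(k < t * T) level (m + k) ^+ 2.
  have step : B <= (33/32) ^+ 2 * \sum_(k < N | (m <= k)%N) level k ^+ 2.
    rewrite mulr_sumr /B [leRHS]big_mkcond [leLHS]big_mkcond.
    apply: ler_sum => k _ /=; case: ifPn => [/[dup] kw /andP[k1 k2]|_]; last first.
      by case: ifP => // _; rewrite mulr_ge0 ?sqr_ge0.
    rewrite mmin ?kw ?ltn_ord //.
    by have := level_gt0 k; rewrite -exprMn => ?; rewrite lerXn2r ?nnegrE //; lra.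
  apply: (le_trans step); apply: (ler_wpM2l (sqr_ge0 _)).
  rewrite -(big_mkord (fun k => (m <= k)%N) (fun k => level k ^+ 2)) /=.
  rewrite (@big_cat_nat _ _ _ m) //= ?(ltnW mN) // big_nat_cond big1 ?add0r.
    rewrite -{1}[m]add0n big_addn big_mkcond /=.
    rewrite [(t * T)%N]mulnC -(big_mkord xpredT (fun k => level (m + k) ^+ 2)) /=.
    rewrite [leRHS](@big_cat_nat _ _ _ (N - m)) ?leq_subr //=.
    rewrite -[leLHS]addr0 lerD //; last by apply: sumr_ge0 => *; exact: sqr_ge0.
    by apply: ler_sum => k _; rewrite leq_addl addnC.
  by move=> k /andP[/andP[_ km] mk]; move: km; rewrite ltnNge mk.
have hs := sum_level_sq m t T_gt0.
have Tg : T%:R * level m ^+ 2 <= T%:R * (64 * GG).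
  by rewrite ler_pM2l ?ltr0n //; lra.
lra.
Qed.

Lemma diffs_sq_le : \sum_(k < N) D k ^+ 2 <= 4 * \sum_(k < N) w k.+1 ^+ 2.
Proof.
apply: (@le_trans _ _ (2 * \sum_(k < N) w k.+1 ^+ 2 + 2 * \sum_(k < N) w k ^+ 2)).
  rewrite !mulr_sumr -big_split /=; apply: ler_sum => k _; rewrite diffs_lt //.
  exact: link_sub_sq_le.
have : \sum_(k < N) w k ^+ 2 <= \sum_(k < N) w k.+1 ^+ 2.
  elim: {+}N => [|n]; first by rewrite !big_ord0.
  move=> _; rewrite big_ord_recl w0 expr0n add0r big_ord_recr /= lerDl.
  exact: sqr_ge0.
lra.
Qed.

End Forward.

(** The difference operator and its adjoint each have squared norm at most 4. *)
Lemma diffs_shift_sq_le w : w 0 = 0 ->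
  \sum_(k < N) (diffs w k - link k.+1 * diffs w k.+1) ^+ 2 <=
  16 * \sum_(k < N) w k.+1 ^+ 2.
Proof.
move=> w0; have h := diffs_sq_le w0.
apply: (@le_trans _ _ (2 * \sum_(k < N) diffs w k ^+ 2
    + 2 * \sum_(k < N) diffs w k.+1 ^+ 2)).
  rewrite !mulr_sumr -big_split /=; apply: ler_sum => k _.
  exact: link_sub_sq_le.
have : \sum_(k < N) diffs w k.+1 ^+ 2 <= \sum_(k < N) diffs w k ^+ 2.
  have := @big_ord_recr R 0 +%R N (fun k : 'I_N.+1 => diffs w k ^+ 2).
  rewrite big_ord_recl /= diffs_last expr0n addr0 => <-.
  by rewrite lerDr sqr_ge0.
lra.
Qed.

End Chain.

(** * Gradients from quadratic expansions *)

Lemma coord_le_norm (R : realType) d (h : 'rV[R]_d) i : `|h 0 i| <= `|h|.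
Proof.
rewrite [`|h|]mx_normrE.
exact: (le_bigmax _ (fun j : 'I_1 * 'I_d => `|h j.1 j.2|) (0, i)).
Qed.

Lemma enorm_sq (R : realType) d (x : 'rV[R]_d) :
  enorm x ^+ 2 = \sum_(i < d) x 0 i ^+ 2.
Proof. by rewrite sqr_sqrtr // sumr_ge0 // => i _; exact: sqr_ge0. Qed.

(** A quadratic remainder is o(h), and the differential is unique. Using [|C| + 1] in place of [C]
    makes the divisor positive. *)
Lemma quadratic_expansion (R : realType) (V W : normedModType R) (f : V -> W)
    (df : {linear V -> W}) (x : V) (C : R) : continuous df ->
  (forall h, `|f (x + h) - f x - df h| <= C * `|h| ^+ 2) ->
  differentiable f x /\ 'd f x = df :> (V -> W).
Proof.
move=> dfc expansion.
have dxf : f \o shift x = cst (f x) + df +o_ 0 id.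
  apply/eqaddoP => eps eps0.
  have K0 : 0 < `|C| + 1 by rewrite ltr_wpDl.
  have eK : 0 < eps / (`|C| + 1) by rewrite divr_gt0.
  near=> h.
  have hh : `|h| <= eps / (`|C| + 1) by near: h; exact: nbhs0_le.
  rewrite !fctE /= [h + x]addrC opprD addrA.
  apply: (le_trans (expansion h)); rewrite expr2 mulrA ler_wpM2r //.
  apply: (@le_trans _ _ ((`|C| + 1) * `|h|)).
    by rewrite ler_wpM2r // ler_wpDr // ler_norm.
  by rewrite mulrC -ler_pdivlMr.
have dE := diff_unique dfc dxf.
by split=> //; apply/diff_locallyP; rewrite dE.
Unshelve. all: by end_near. Qed.

(** The remainder is measured by the Euclidean norm, differentiability by the maximum norm of rows;
    their squares compare up to the factor [d]. *)
Lemma grad_quadratic_expansion (R : realType) d (f : 'rV[R]_d -> R)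
    (x G : 'rV[R]_d) (C : R) :
  (forall h : 'rV[R]_d, `|f (x + h) - f x - \sum_(i < d) G 0 i * h 0 i| <=
    C * \sum_(i < d) h 0 i ^+ 2) ->
  differentiable f x /\ grad f x = G.
Proof.
move=> expansion.
pose dot (h : 'rV[R]_d) : R := \sum_(i < d) G 0 i * h 0 i.
have dot_linear : linear dot.
  move=> a u v; rewrite /dot scaler_sumr -big_split; apply: eq_bigr => i _ /=.
  by rewrite !mxE mulrDr mulrCA.
pose df : {linear 'rV[R]_d -> R} :=
  HB.pack dot (GRing.isLinear.Build _ _ _ _ dot dot_linear).
have dfc : continuous df.
  apply/linear_bounded_continuous/linear_boundedP.
  exists (\sum_(i < d) `|G 0 i|); split; first exact: num_real.
  move=> c hc h; apply: (@le_trans _ _ ((\sum_(i < d) `|G 0 i|) * `|h|)); last first.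
    by rewrite ler_wpM2r // ltW.
  rewrite /= /dot (le_trans (ler_norm_sum _ _ _)) // mulr_suml.
  by apply: ler_sum => i _; rewrite normrM ler_wpM2l // coord_le_norm.
have [|fx dE] := @quadratic_expansion R _ _ f df x (`|C| * d%:R) dfc.
  move=> h; apply: (le_trans (expansion h)).
  have hs : \sum_(i < d) h 0 i ^+ 2 <= d%:R * `|h| ^+ 2.
    have -> : d%:R * `|h| ^+ 2 = \sum_(i < d) `|h| ^+ 2.
      by rewrite sumr_const card_ord mulr_natl.
    apply: ler_sum => i _; rewrite -[h 0 i ^+ 2]ger0_norm ?sqr_ge0 // normrX.
    by rewrite lerXn2r ?nnegrE // coord_le_norm.
  apply: (@le_trans _ _ (`|C| * \sum_(i < d) h 0 i ^+ 2)).
    by rewrite ler_wpM2r ?ler_norm // sumr_ge0 // => i _; exact: sqr_ge0.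
  by rewrite -mulrA ler_wpM2l.
split=> //; apply/rowP => i; rewrite mxE dE /= /dot.
rewrite (bigD1 i) //= mxE !eqxx mulr1 big1 ?addr0 // => j ji.
by rewrite mxE (negbTE ji) andbF mulr0.
Qed.

(** * The function g *)

Section Coordinates.
Variables (R : realType) (d : nat).
Implicit Types (x h : 'rV[R]_d).

Lemma xcS x (i : 'I_d) : xc x i.+1 = x 0 i.
Proof. by rewrite /= valK. Qed.

Lemma xcD x h k : xc (x + h) k = xc x k + xc h k.
Proof. by case: k => [|k] /=; [|case: insub => [i|]]; rewrite ?mxE ?addr0. Qed.

Lemma xcN x k : xc (- x) k = - xc x k.
Proof. by case: k => [|k] /=; [|case: insub => [i|]]; rewrite ?mxE ?oppr0. Qed.

End Coordinates.

Section Grid.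
Variables (R : realType) (T t : nat).
Hypothesis T_gt0 : (0 < T)%N.
Implicit Types (x h w : 'rV[R]_(T * t)).

Local Notation N := (T * t)%N.
Local Notation y := (y_vec R T t).
Local Notation df := (diffs T t).
Local Notation energy := (chain_energy T t).

Lemma y_vecE (m : 'I_N) : y 0 m = level R T m.
Proof. by rewrite mxE. Qed.

Lemma sum_blocks (F : nat -> R) n :
  \sum_(k < T * n) F k = \sum_(0 <= i < n) \sum_(0 <= j < T) F (i * T + j)%N.
Proof.
elim: n => [|n IH]; first by rewrite muln0 big_ord0 big_geq.
rewrite big_nat_recr //= -IH mulnSr big_split_ord /=; congr (_ + _).
by rewrite [RHS]big_mkord; apply: eq_bigr => j _; rewrite mulnC.
Qed.

(** The double sum over blocks is one chain: the first term of each block carries the factor 7/8 of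
    [link], up to sign. *)
Lemma q_funE x : q_fun x = energy (xc x).
Proof.
rewrite /q_fun /chain_energy (sum_blocks (fun k => df (xc x) k ^+ 2)).
congr (_ / 2); rewrite !big_nat; apply: eq_bigr => i /andP[_ it].
have lt j : (j < T)%N -> (i * T + j < N)%N.
  by move=> jT; apply: (@leq_trans (i.+1 * T)); [rewrite mulSnr ltn_add2l
    | rewrite [N]mulnC leq_mul2r it orbT].
rewrite [RHS]big_ltn // addn0; congr (_ + _).
  rewrite diffs_lt ?addn1 /link ?dvdn_mull //; last by rewrite -[(i * T)%N]addn0 lt.
  by rewrite -sqrrN opprB.
rewrite [LHS]big_nat [RHS]big_nat; apply: eq_bigr => j /andP[j1 jT].
rewrite diffs_lt ?lt // addn1 /link dvdn_addr ?dvdn_mull //.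
by rewrite gtnNdvd // mul1r.
Qed.

Lemma g_funE x : g_fun x =
  energy (xc x) + \sum_(m < N) v_fun (level R T m) (xc x m.+1).
Proof.
rewrite /g_fun q_funE; congr (_ + _); apply: eq_bigr => m _.
by rewrite y_vecE xcS.
Qed.

Definition g_grad x : 'rV[R]_N := \row_m chain_grad T t (xc x) m.

Lemma diffsD x h k : df (xc (x + h)) k = df (xc x) k + df (xc h) k.
Proof. by rewrite /diffs; case: ifP => _; rewrite ?xcD; ring. Qed.

Lemma diffsN x k : df (xc (- x)) k = - df (xc x) k.
Proof. by rewrite /diffs; case: ifP => _; rewrite ?xcN; ring. Qed.

(** 35 = 2 + 33: the energy of [h] is at most half of 4 |h|^2, and the wells contribute 33. *)
Lemma g_fun_expansion x h :
  `|g_fun (x + h) - g_fun x - \sum_(i < N) g_grad x 0 i * h 0 i| <=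
  35 * \sum_(i < N) h 0 i ^+ 2.
Proof.
have xh0 : xc h 0 = 0 by [].
have hE : \sum_(i < N) h 0 i ^+ 2 = \sum_(i < N) xc h i.+1 ^+ 2.
  by apply: eq_bigr => i _; rewrite xcS.
have dh := diffs_sq_le T t xh0.
have sp := sum_by_parts (@link R T) (df (xc x)) N xh0.
rewrite diffs_last mulr0 mul0r addr0 in sp.
have dE : \sum_(k < N) df (xc x) k * (xc h k.+1 - link R T k * xc h k) =
    \sum_(k < N) df (xc x) k * df (xc h) k.
  by apply: eq_bigr => k _; rewrite [df (xc h) k]diffs_lt.
rewrite dE in sp.
have energyE : energy (xc (x + h)) - energy (xc x) =
    \sum_(k < N) (df (xc x) k - link R T k.+1 * df (xc x) k.+1) * xc h k.+1
    + (\sum_(k < N) df (xc h) k ^+ 2) / 2.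
  rewrite -sp /chain_energy -mulrBl -sumrB !mulr_suml -big_split /=.
  by apply: eq_bigr => k _; rewrite diffsD; field.
have wells : `|\sum_(m < N) (v_fun (level R T m) (xc (x + h) m.+1)
      - v_fun (level R T m) (xc x m.+1)
      - dv_fun (level R T m) (xc x m.+1) * xc h m.+1)| <=
    33 * \sum_(i < N) xc h i.+1 ^+ 2.
  rewrite (le_trans (ler_norm_sum _ _ _)) // mulr_sumr; apply: ler_sum => m _.
  by rewrite xcD; apply: v_fun_taylor; exact: level_gt0.
have -> : g_fun (x + h) - g_fun x - \sum_(i < N) g_grad x 0 i * h 0 i =
    (\sum_(k < N) df (xc h) k ^+ 2) / 2 +
    \sum_(m < N) (v_fun (level R T m) (xc (x + h) m.+1)
      - v_fun (level R T m) (xc x m.+1)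
      - dv_fun (level R T m) (xc x m.+1) * xc h m.+1).
  have -> : \sum_(i < N) g_grad x 0 i * h 0 i =
      \sum_(k < N) (df (xc x) k - link R T k.+1 * df (xc x) k.+1) * xc h k.+1
      + \sum_(k < N) dv_fun (level R T k) (xc x k.+1) * xc h k.+1.
    by rewrite -big_split /=; apply: eq_bigr => k _; rewrite mxE -xcS mulrDl.
  rewrite !sumrB !g_funE; move: energyE.
  by set a := \sum_(k < N) (_ - _) * _; lra.
rewrite hE; apply: (le_trans (ler_normD _ _)).
have D0 : 0 <= \sum_(k < N) df (xc h) k ^+ 2.
  by apply: sumr_ge0 => k _; exact: sqr_ge0.
rewrite ger0_norm; first by lra.
by lra.
Qed.

(** 37 = 4 + 33: norm of the linear part plus Lipschitz constant of the wells. *)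
Lemma g_grad_lipschitz x z :
  \sum_(i < N) (g_grad x 0 i - g_grad z 0 i) ^+ 2 <=
  37 ^+ 2 * \sum_(i < N) (x 0 i - z 0 i) ^+ 2.
Proof.
pose u := x - z.
have u0 : xc u 0 = 0 by [].
have uE k : xc x k - xc z k = xc u k by rewrite xcD xcN.
have hE : \sum_(i < N) (x 0 i - z 0 i) ^+ 2 = \sum_(i < N) xc u i.+1 ^+ 2.
  by apply: eq_bigr => i _; rewrite xcS !mxE.
have linear_part := diffs_shift_sq_le T t u0.
have wells : \sum_(k < N) (dv_fun (level R T k) (xc x k.+1)
      - dv_fun (level R T k) (xc z k.+1)) ^+ 2 <=
    33 ^+ 2 * \sum_(k < N) xc u k.+1 ^+ 2.
  rewrite mulr_sumr; apply: ler_sum => k _; rewrite -uE.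
  by apply: dv_fun_lipschitz; exact: level_gt0.
(* (p + r)^2 <= (1 + 33/4) p^2 + (1 + 4/33) r^2, optimal for the norms 4 and 33 *)
apply: (@le_trans _ _ (37/4 * \sum_(k < N)
    (df (xc u) k - link R T k.+1 * df (xc u) k.+1) ^+ 2 +
  37/33 * \sum_(k < N) (dv_fun (level R T k) (xc x k.+1)
      - dv_fun (level R T k) (xc z k.+1)) ^+ 2)).
  rewrite !mulr_sumr -big_split /=; apply: ler_sum => k _.
  rewrite !mxE /chain_grad !diffsD !diffsN.
  set p := (X in 37/4 * X ^+ 2); set r := (X in 37/33 * X ^+ 2).
  rewrite [X in X ^+ 2 <= _](_ : _ = p + r); last by rewrite /p /r; ring.
  by have := sqr_ge0 (33 * p - 4 * r); lra.
by rewrite hE; lra.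
Qed.

(** * Values of g, its PL inequality and untouched coordinates *)

Lemma g_fun_ge0 x : 0 <= g_fun x.
Proof.
rewrite g_funE addr_ge0 //.
  by rewrite divr_ge0 // sumr_ge0 // => k _; exact: sqr_ge0.
by apply: sumr_ge0 => k _; apply: v_fun_ge0; exact: level_gt0.
Qed.

Lemma g_fun0 : @g_fun R T t 0 = 0.
Proof.
have x0 k : xc (0 : 'rV[R]_N) k = 0.
  by case: k => [|k] //=; case: insub => [i|] //; rewrite mxE.
rewrite g_funE /chain_energy !big1 ?mul0r ?addr0 //.
  by move=> k _; rewrite x0 v_fun0 // level_gt0.
by move=> k _; rewrite diffs_lt // !x0 mulr0 subr0 expr0n.
Qed.

(** The energy is at most 2 |x|^2 and the wells at most |x|^2 / 2, so 1455 = 5/2 * 582. *)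
Lemma g_fun_PL x :
  g_fun x <= 1455 * T%:R * \sum_(i < N) g_grad x 0 i ^+ 2.
Proof.
have x0 : xc x 0 = 0 by [].
have h1 := diffs_sq_le T t x0.
have h2 := chain_sq_le t T_gt0 x0.
have h3 : \sum_(m < N) v_fun (level R T m) (xc x m.+1) <=
    (\sum_(k < N) xc x k.+1 ^+ 2) / 2.
  by rewrite mulr_suml; apply: ler_sum => k _; apply: v_fun_le; exact: level_gt0.
have -> : \sum_(i < N) g_grad x 0 i ^+ 2 = \sum_(k < N) chain_grad T t (xc x) k ^+ 2.
  by apply: eq_bigr => k _; rewrite mxE.
by rewrite g_funE /chain_energy; lra.
Qed.

Lemma xc_y k : (k < N)%N -> xc y k.+1 = level R T k.
Proof. by move=> kN; rewrite -[k]/(nat_of_ord (Ordinal kN)) xcS y_vecE. Qed.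

(** 77/30 = 31/64 * 64/15 + 1/2: the wells, and the energy of the only nonzero difference, which is
    the first. *)
Lemma g_fun_y_le : (0 < t)%N -> g_fun y <= 77/30 * T%:R.
Proof.
move=> t0; have N0 : (0 < N)%N by rewrite muln_gt0 T_gt0.
have hs := sum_level_sq R 0 t T_gt0; rewrite [(t * T)%N]mulnC in hs.
have level0 : level R T 0 = 1 by rewrite /level div0n expr0.
rewrite level0 in hs.
have T1 : 1 <= T%:R :> R by rewrite ler1n.
have hv : \sum_(m < N) v_fun (level R T m) (xc y m.+1) =
    31/64 * \sum_(m < N) level R T (0 + m) ^+ 2.
  by rewrite mulr_sumr; apply: eq_bigr => m _; rewrite xc_y // v_fun_min ?level_gt0.
have hd : \sum_(k < N) df (xc y) k ^+ 2 = 1.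
  rewrite (bigD1 (Ordinal N0)) //= big1 ?addr0.
    by rewrite diffs_lt // xc_y // level0 mulr0 subr0 expr1n.
  move=> [[|k] kN] //= _.
  by rewrite diffs_lt // !xc_y ?(ltnW kN) // levelS // subrr expr0n.
by rewrite g_funE /chain_energy hd hv; lra.
Qed.

(** Entry [i] depends only on coordinates i - 1, i and i + 1, which all agree with [y]: both
    differences and the slope of the well vanish. *)
Lemma g_grad_untouched x n (i : 'I_N) :
  (forall m : 'I_N, (n <= m)%N -> x 0 m = y 0 m) -> (n < i)%N ->
  g_grad x 0 i = 0.
Proof.
move=> xy ni; rewrite mxE /chain_grad.
have xl k : (n <= k)%N -> (k < N)%N -> xc x k.+1 = level R T k.
  by move=> nk kN; rewrite -[k]/(nat_of_ord (Ordinal kN)) xcS xy // y_vecE.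
have d0 k : (n < k)%N -> df (xc x) k = 0.
  case: k => // k nk; rewrite /diffs; case: ifP => // kN.
  by rewrite (xl _ (ltnW nk) kN) (xl _ nk (ltnW kN)) levelS // subrr.
rewrite (d0 _ ni) (d0 _ (leqW ni)) (xl _ (ltnW ni) (ltn_ord i)).
by rewrite dv_fun_min ?level_gt0 // mulr0 subr0 addr0.
Qed.

End Grid.

(** Each of the T coordinates of the last block contributes 31/64 times its squared level
    (49/64)^n. *)
Lemma g_fun_untouched (R : realType) (T n : nat) (x : 'rV[R]_(T * n.+1)) :
  (0 < T)%N ->
  (forall m : 'I_(T * n.+1), (T * n <= m)%N -> x 0 m = y_vec R T n.+1 0 m) ->
  31/64 * T%:R * (49/64) ^+ n <= g_fun x.
Proof.
move=> T0 xy; rewrite g_funE //.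
set E := chain_energy _ _ _; have E0 : 0 <= E.
  by rewrite divr_ge0 // sumr_ge0 // => k _; exact: sqr_ge0.
have e : (T * n.+1 = T * n + T)%N by rewrite mulnSr.
apply: (@le_trans _ _ (\sum_(m < T * n.+1 | (T * n <= m)%N)
    v_fun (level R T m) (xc x m.+1))); last first.
  rewrite -[leLHS]add0r lerD // [leRHS](bigID (fun m : 'I__ => (T * n <= m)%N)) /=.
  by rewrite lerDl; apply: sumr_ge0 => k _; apply: v_fun_ge0; exact: level_gt0.
have -> : \sum_(m < T * n.+1 | (T * n <= m)%N) v_fun (level R T m) (xc x m.+1) =
    \sum_(m < T * n.+1 | (T * n <= m)%N) 31/64 * level R T m ^+ 2.
  apply: eq_bigr => m nm; rewrite xcS xy // y_vecE.
  by rewrite v_fun_min // level_gt0.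
rewrite -(big_mkord (fun m => (T * n <= m)%N) (fun m => 31/64 * level R T m ^+ 2)).
rewrite (@big_cat_nat _ _ _ (T * n)) ?leq_mul //= [X in _ <= X + _]big_nat_cond.
rewrite [X in _ <= X + _]big1 ?add0r; last first.
  by move=> k /andP[/andP[_ km] mk]; move: km; rewrite ltnNge mk.
rewrite e -[X in \sum_(X <= _ < _ | _) _]add0n big_addn addnC addnK big_mkcond /=.
rewrite big_mkord (eq_bigr (fun=> 31/64 * (49/64) ^+ n)) ?sumr_const ?card_ord.
  by rewrite -[leRHS]mulr_natr; lra.
move=> k _; rewrite leq_addl /level divnDr ?dvdn_mulr // mulKn // divn_small //.
by rewrite add0n exprAC; congr (_ * _ ^+ _); field.
Qed.

(** * The rescaled function and the lower bound *)

Lemma rowZE (R : realType) d (a : R) (v : 'rV[R]_d) i : (a *: v) 0 i = a * v 0 i.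
Proof. by rewrite mxE. Qed.

Section Rescaled.
Variables (R : realType) (L D : R) (T t : nat).
Hypotheses (L_gt0 : 0 < L) (D_gt0 : 0 < D) (T_gt0 : (0 < T)%N).
Implicit Types (x h : 'rV[R]_(T * t)).

Local Notation f := (@gtilde R L D T t).
Local Notation y := (y_vec R T t).

Definition amplitude : R := L * (T%:R)^-1 * D ^+ 2 / 37.
Definition scale : R := Num.sqrt (T%:R) / D.
Definition recenter x := y - scale *: x.

Lemma gtildeE x : f x = amplitude * g_fun (recenter x).
Proof. by []. Qed.

Lemma scale_gt0 : 0 < scale.
Proof. by rewrite divr_gt0 // sqrtr_gt0 ltr0n. Qed.

Lemma amplitude_gt0 : 0 < amplitude.
Proof. by rewrite /amplitude !mulr_gt0 ?invr_gt0 ?exprn_gt0 ?ltr0n. Qed.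

(** The factor by which second-order terms are multiplied; T and D cancel, and 37 offsets the
    constant of [g_grad_lipschitz]. *)
Lemma amplitude_scale : amplitude * scale ^+ 2 = L / 37.
Proof.
have T0 : T%:R != 0 :> R by rewrite pnatr_eq0 -lt0n.
rewrite /amplitude /scale expr_div_n sqr_sqrtr // .
by field; rewrite T0 lt0r_neq0.
Qed.

Lemma gtilde_diff x :
  differentiable f x /\ grad f x = - (amplitude * scale) *: g_grad (recenter x).
Proof.
apply: (@grad_quadratic_expansion _ _ _ _ _ (35 * (L / 37))) => h.
have A0 := amplitude_gt0.
have -> : f (x + h) = amplitude * g_fun (recenter x + - scale *: h).
  by rewrite gtildeE /recenter scalerDr opprD addrA scaleNr.
have := g_fun_expansion T_gt0 (recenter x) (- scale *: h).
rewrite -(ler_pM2l A0) -[X in X * `|_|]gtr0_norm // -normrM.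
have -> : \sum_(i < T * t) (- scale *: h) 0 i ^+ 2 =
    scale ^+ 2 * \sum_(i < T * t) h 0 i ^+ 2.
  by rewrite mulr_sumr; apply: eq_bigr => i _; rewrite mxE mulNr sqrrN exprMn.
have -> : \sum_(i < T * t) g_grad (recenter x) 0 i * (- scale *: h) 0 i =
    - scale * \sum_(i < T * t) g_grad (recenter x) 0 i * h 0 i.
  by rewrite mulr_sumr; apply: eq_bigr => i _; rewrite rowZE; ring.
have -> : \sum_(i < T * t) (- (amplitude * scale) *: g_grad (recenter x)) 0 i * h 0 i =
    - (amplitude * scale) * \sum_(i < T * t) g_grad (recenter x) 0 i * h 0 i.
  by rewrite mulr_sumr; apply: eq_bigr => i _; rewrite rowZE; ring.
rewrite -amplitude_scale gtildeE => H.
rewrite [leRHS](_ : _ = amplitude * (35 * (scale ^+ 2 *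
  \sum_(i < T * t) h 0 i ^+ 2))); last by ring.
apply: le_trans H.
by rewrite le_eqVlt; apply/orP; left; apply/eqP; congr (`|_|); ring.
Qed.

Lemma gtilde_differentiable : differentiable_everywhere f.
Proof. by move=> x; have [] := gtilde_diff x. Qed.

Lemma grad_gtilde x : grad f x = - (amplitude * scale) *: g_grad (recenter x).
Proof. by have [] := gtilde_diff x. Qed.

Lemma gtilde_smooth : L_smooth L f.
Proof.
split=> [|x z]; first exact: gtilde_differentiable.
rewrite -ler_sqr ?nnegrE ?mulr_ge0 ?sqrtr_ge0 ?(ltW L_gt0) //.
rewrite exprMn !enorm_sq !grad_gtilde.
have h := g_grad_lipschitz (recenter x) (recenter z).
have e1 : \sum_(i < T * t) ((- (amplitude * scale) *: g_grad (recenter x)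
      - - (amplitude * scale) *: g_grad (recenter z)) 0 i) ^+ 2 =
    (amplitude * scale) ^+ 2 *
    \sum_(i < T * t) (g_grad (recenter x) 0 i - g_grad (recenter z) 0 i) ^+ 2.
  by rewrite mulr_sumr; apply: eq_bigr => i _; rewrite !mxE; ring.
have e2 : \sum_(i < T * t) (recenter x 0 i - recenter z 0 i) ^+ 2 =
    scale ^+ 2 * \sum_(i < T * t) (x - z) 0 i ^+ 2.
  by rewrite mulr_sumr; apply: eq_bigr => i _; rewrite !mxE; ring.
rewrite e1; rewrite e2 in h.
have -> : L ^+ 2 = (amplitude * scale) ^+ 2 * (37 ^+ 2 * scale ^+ 2).
  transitivity ((37 * (amplitude * scale ^+ 2)) ^+ 2); last by ring.
  by rewrite amplitude_scale; field.
rewrite -[leRHS]mulrA; apply: (ler_wpM2l (sqr_ge0 _)).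
by rewrite -mulrA.
Qed.

(** The point [scale^-1 *: y] is recentered to 0, where the nonnegative g vanishes. *)
Lemma inff_gtilde : inff f = 0.
Proof.
have s0 := scale_gt0; have A0 := amplitude_gt0.
have f0 : f (scale^-1 *: y) = 0.
  rewrite gtildeE /recenter scalerA divff ?lt0r_neq0 // scale1r subrr.
  by rewrite g_fun0 // mulr0.
have lb : lbound (range f) 0.
  by move=> _ [x _ <-]; rewrite gtildeE mulr_ge0 ?(ltW A0) // g_fun_ge0.
apply/eqP; rewrite eq_le; apply/andP; split.
  by rewrite -f0; apply: ge_inf; [exists 0 | exists (scale^-1 *: y)].
by apply: lb_le_inf => //; exists (f 0), 0.
Qed.

(** By [g_fun_PL] the factor 2 * 1455 * 37 = 107670 suffices, and 400 * 300 exceeds it. *)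
Lemma gtilde_PL (mu : R) : 400 * 300 * T%:R * mu <= L -> PL mu f.
Proof.
move=> hmu x; rewrite inff_gtilde subr0 enorm_sq grad_gtilde gtildeE.
have A0 := amplitude_gt0.
have -> : \sum_(i < T * t) (- (amplitude * scale) *: g_grad (recenter x)) 0 i ^+ 2 =
    amplitude * (L / 37) * \sum_(i < T * t) g_grad (recenter x) 0 i ^+ 2.
  rewrite -amplitude_scale mulr_sumr; apply: eq_bigr => i _; rewrite rowZE; ring.
have := g_fun_PL T_gt0 (recenter x); have := g_fun_ge0 T_gt0 (recenter x).
have : 0 <= \sum_(i < T * t) g_grad (recenter x) 0 i ^+ 2.
  by apply: sumr_ge0 => i _; exact: sqr_ge0.
move: (\sum_(i < T * t) _) (g_fun _) => S g S0 g0 gS.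
have T0 : 0 < T%:R :> R by rewrite ltr0n.
suff h : 2 * mu * g <= L / 37 * S.
  by rewrite mulrCA -mulrA ler_pM2l.
have [mu0|mu0] := lerP mu 0.
  apply: (@le_trans _ _ 0); first nra.
  by rewrite mulr_ge0 // divr_ge0 // ltW.
apply: (@le_trans _ _ (2 * mu * (1455 * T%:R * S))).
  by rewrite ler_pM2l // mulr_gt0.
have : 0 <= T%:R * mu * S by rewrite !mulr_ge0 // ltW.
by have := ler_wpM2r S0 hmu; lra.
Qed.

Lemma recenter_untouched x (m : 'I_(T * t)) : x 0 m = 0 -> recenter x 0 m = y 0 m.
Proof. by move=> xm; rewrite !mxE xm mulr0 subr0. Qed.

(** Strong induction: an earlier iterate [j] vanishes from coordinate [j] on, so its gradient
    reaches at most coordinate [j], and each step opens one new coordinate. *)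
Lemma iterate_untouched (A : algorithm R (T * t)) :
  zero_respecting A -> A [::] = 0 ->
  forall n (i : 'I_(T * t)), (n <= i)%N -> iterate A f n 0 i = 0.
Proof.
move=> zr A0; have x0 : iterate A f 0 = 0 by [].
elim/ltn_ind => -[|n] IH i ni; first by rewrite x0 mxE.
apply/eqP/negPn/negP => xi.
have /(_ gtilde_differentiable n.+1 isT)/fintype.subsetP/(_ i) := zr f.
rewrite x0 subr0 inE xi => /(_ isT)/finset.bigcupP[j _].
rewrite inE grad_gtilde mxE (@g_grad_untouched _ _ _ T_gt0 _ j) ?mulr0 ?eqxx //.
  by move=> m jm; apply: recenter_untouched; exact: IH.
exact: leq_trans (ltn_ord j) ni.
Qed.

End Rescaled.

(** * Choice of the parameters and the step count *)

Lemma geometric_ge (R : realType) (eps : R) (n : nat) : 0 < eps ->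
  n%:R <= - ln eps -> eps <= (49/64) ^+ n ^+ 2.
Proof.
move=> eps0 hn.
(* 1/2 separates the two rates: 1/e <= 1/2 <= (49/64)^2. *)
have e1 : expR (-1) <= 1/2 :> R.
  have := expR_ge1Dx (1 : R) => h.
  rewrite expRN div1r lef_pV2 ?posrE ?expR_gt0 //; lra.
apply: (@le_trans _ _ ((1/2) ^+ n)).
  rewrite -[eps in leLHS]lnK ?posrE // (@le_trans _ _ (expR (n%:R * -1))) //.
    by rewrite ler_expR; lra.
  by rewrite expRM_natl lerXn2r ?nnegrE ?expR_ge0 //; lra.
by rewrite exprAC lerXn2r ?nnegrE //; lra.
Qed.

Lemma ln_inv_ge1 (R : realType) (eps : R) : 0 < eps -> eps < 1/100 ->
  1 <= ln (1 / eps).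
Proof.
move=> eps0 eps1; rewrite div1r lnV ?posrE // lerNr -(expRK (-1)).
rewrite ler_ln ?posrE ?expR_gt0 //.
have h : 1/2 <= expR (- (1/2)) :> R by have := expR_ge1Dx (- (1/2) : R); lra.
have -> : -1 = 2%:R * - (1/2) :> R by lra.
by rewrite expRM_natl; nra.
Qed.

(** Otherwise p <= 16/3 eps, while p is at least the square root of eps; this forces eps >= 9/256,
    above 1/100. *)
Lemma insufficient_decrease (R : realType) (eps X p gk gy : R) :
  0 < eps -> eps < 1/100 -> 0 < X -> 0 < p -> eps <= p ^+ 2 ->
  31/64 * X * p <= gk -> gy <= 77/30 * X -> ~ gk <= eps * gy.
Proof.
move=> eps0 eps1 X0 p0 pn lower upper hk.
have h1 : X * (31/64 * p) <= X * (77/30 * eps).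
  by have := ler_wpM2l (ltW eps0) upper; lra.
rewrite ler_pM2l // in h1.
have h2 : p ^+ 2 <= (16/3 * eps) ^+ 2 by rewrite lerXn2r ?nnegrE //; lra.
have h3 : 0 < eps * (1/100 - eps) by apply: mulr_gt0; lra.
by clear -h2 h3 pn eps0; lra.
Qed.

Lemma ratr_natM (R : realType) (a b : nat) :
  ratr (a%:R * b%:R) = a%:R * b%:R :> R.
Proof. by rewrite rmorphM /= !ratr_nat. Qed.

Theorem theorem2 :
  exists C4 c : rat, 0 < C4 /\ 0 < c /\
  forall (R : realType) (L mu : R), 0 < mu -> mu <= L -> ratr C4 < L / mu ->
  forall eps : R, 0 < eps -> eps < 1/100 ->
  forall D : R, 0 < D ->
  exists T t : nat, (0 < T)%N /\ (0 < t)%N /\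
    L_smooth L (@gtilde R L D T t) /\
    PL mu (@gtilde R L D T t) /\
    forall A : algorithm R (T * t), zero_respecting A ->
      A [::] = 0 ->
      forall k : nat,
        gtilde L D (iterate A (@gtilde R L D T t) k) - inff (@gtilde R L D T t)
        <= eps * (gtilde L D (iterate A (@gtilde R L D T t) 0)
                  - inff (@gtilde R L D T t)) ->
        ratr c * (L / mu) * ln (1 / eps) <= k%:R.
Proof.
(* [C4] is the constant of [gtilde_PL], so that kappa > C4 leaves room for a block length T >= 1.
   The factor 4 in c pays for two roundings. *)
have [C4 C4_gt0 C4E] : exists2 q : rat, 0 < q &
    forall R : realType, ratr q = 400 * 300 :> R.
  exists (400%:R * 300%:R) => [|R]; first by rewrite mulr_gt0 ?ltr0n.
  exact: ratr_natM.
have c_gt0 : 0 < (C4 * 4)^-1 by rewrite invr_gt0 mulr_gt0.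
exists C4, (C4 * 4)^-1; do 2!split => //.
move=> R L mu mu0 muL; rewrite fmorphV rmorphM /= ratr_nat C4E.
move=> hkappa eps eps0 eps1 D D0.
have L0 : 0 < L by exact: lt_le_trans muL.
set kappa := L / mu in hkappa *.
have kE : L = kappa * mu by rewrite /kappa divfK // lt0r_neq0.
set r := kappa / (400 * 300).
have r1 : 1 < r by rewrite /r; lra.
have r0 : 0 <= r by lra.
have /andP[Tle Tgt] := truncn_itv r0.
set T := Num.truncn r in Tle Tgt *.
have T0 : (0 < T)%N by rewrite truncn_gt0 ltW.
have l1 := ln_inv_ge1 eps0 eps1.
set l := ln (1 / eps) in l1 *.
have l0 : 0 <= l by lra.
have /andP[nle ngt] := truncn_itv l0.
set n := Num.truncn l in nle ngt *.
have n0 : (0 < n)%N by rewrite truncn_gt0.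
(* T <= r is the PL requirement; the n blocks before the last have to be crossed first. *)
exists T, n.+1; do 2!split => //; split; first exact: gtilde_smooth.
split.
  apply: gtilde_PL => //; rewrite kE ler_pM2r //.
  by move: Tle; rewrite /r; lra.
move=> A zr A0 k; rewrite !inff_gtilde // !subr0.
have -> : iterate A (@gtilde R L D T n.+1) 0 = 0 by [].
(* With k <= T n the last block is still untouched, and its value alone contradicts [hk]. *)
move=> hk; have kT : (T * n < k)%N.
  rewrite ltnNge; apply/negP => kTn.
  have untouched (m : 'I_(T * n.+1)) : (T * n <= m)%N ->
      recenter D (iterate A (@gtilde R L D T n.+1) k) 0 m = y_vec R T n.+1 0 m.
    move=> nm; apply: recenter_untouched; apply: iterate_untouched => //.
    exact: leq_trans nm.
  have lower := g_fun_untouched T0 untouched.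
  have upper := g_fun_y_le R T0 (ltn0Sn n).
  have pn : eps <= (49/64) ^+ n ^+ 2.
    by apply: geometric_ge => //; rewrite -lnV ?posrE // -div1r.
  have p0 : 0 < (49/64 : R) ^+ n by rewrite exprn_gt0.
  move: hk; rewrite !gtildeE mulrCA ler_pM2l ?amplitude_gt0 //.
  have -> : recenter D (0 : 'rV[R]_(T * n.+1)) = y_vec R T n.+1.
    by rewrite /recenter scaler0 subr0.
  move: (g_fun _) (g_fun _) lower upper => gk gy lower upper hk.
  have T0' : 0 < T%:R :> R by rewrite ltr0n.
  exact: (insufficient_decrease eps0 eps1 T0' p0 pn lower upper hk).
have hk' : T%:R * n%:R <= k%:R :> R by rewrite -natrM ler_nat ltnW.
apply: le_trans hk'.
have n1 : 1 <= n%:R :> R by rewrite ler1n.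
have T1 : 1 <= T%:R :> R by rewrite ler1n.
rewrite -natr1 in Tgt; rewrite -natr1 in ngt.
(* The integer part of a real that is at least 1 is at least half of it. *)
apply: (@le_trans _ _ (r / 2 * (l / 2))); first by rewrite /r; lra.
by apply: ler_pM; lra.
Qed.
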